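(* Let $T\subset \mathbb{R}^n$ be a closed regular set and let $I\subset \mathbb{Z}_{+}^n$ be a finite regular set. Let $g=(g_i)_{i\in I}$ be a set of real numbers with $g_0=1$. The following statements are equivalent: (a) There exists a function $f\in L^1_+(T,dt)$ such that $\int_T |t^i|\, f(t)\,dt<\infty$ and $\int_T t^i f(t)\,dt=g_i$ for all $i\in I$. (b) The Riesz functional $\varphi_g:P_I\to\mathbb{R}$, defined on the linear span $P_I\subset \mathbb{R}[X_1,\ldots,X_n]$ of the monomials $X^i$, $i\in I$, by $$\varphi_g\Big(\sum_{i\in I} c_i X^i\Big)=\sum_{i\in I} g_i c_i ,$$ satisfies $\varphi_g\, p>0$ for every $p\in P_I\setminus\{0\}$ such that $p(t)\geq 0$ for all $t\in T$.
   Context: Multi-index notation: for $i=(i_1,\ldots,i_n)\in\mathbb{Z}_{+}^n$ (nonnegative integers) and $t=(t_1,\ldots,t_n)\in\mathbb{R}^n$, $t^i=t_1^{i_1}\cdots t_n^{i_n}$ and $X^i=X_1^{i_1}\cdots X_n^{i_n}$. The Lebesgue measure on $\mathbb{R}^n$ is $dt$, $\|\cdot\|$ is the Euclidean norm, and $L^1_+(T,dt)$ is the set of functions in $L^1(T,dt)$ that are $\geq 0$ almost everywhere. A closed set $T\subset\mathbb{R}^n$ is called regular if $T\neq\emptyset$ and for every $t\in T$ and every $\varepsilon>0$ the set $\{x\in T:\|x-t\|<\varepsilon\}$ has Lebesgue measure $>0$. For $i\in\mathbb{Z}_{+}^n$ let $\sigma_i=\{j\in\mathbb{Z}_{+}^n: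 \text{for each } 1\leq k\leq n,\ j_k=0 \text{ or } j_k=i_k\}$. A finite set $I\subset\mathbb{Z}_{+}^n$ is called regular if $I\neq\emptyset$ and $\sigma_i\subset I$ for all $i\in I$ (in particular $0\in I$). *)

(* Defs.v *)
From HB Require Import structures.
From mathcomp Require Import all_boot all_order all_algebra finmap ring lra.
(* Without the notations of mpoly, which clash with those of MathComp-Analysis. *)
From mathcomp Require Import -(notations) mpoly.
From mathcomp Require Import all_classical all_reals all_analysis.

Set Implicit Arguments.
Unset Strict Implicit.
Unset Printing Implicit Defensive.

Import Order.TTheory GRing.Theory Num.Theory.
Import numFieldNormedType.Exports.

Local Open Scope classical_set_scope.
Local Open Scope ring_scope.

Fact rV_display : measure_display. Proof. exact: default_measure_display. Qed.

(* The points of R^n are row vectors, with the library's (product) topology;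
   their sigma-algebra is the product one, i.e. generated by the coordinate
   maps, as the library does for n.-tuple T. It is the Borel sigma-algebra:
   see measurable_rV_borel below. *)
Section measurable_rV.
Context (R : realType) (n : nat).

Definition rV_coord (i : 'I_n) (x : 'rV[R]_n) : measurableTypeR R := x ord0 i.

Let rV_set0 : g_sigma_preimage rV_coord set0.
Proof. exact: sigma_algebra0. Qed.

Let rV_setC A : g_sigma_preimage rV_coord A -> g_sigma_preimage rV_coord (~` A).
Proof. exact: sigma_algebraC. Qed.

Let rV_bigcup (F : (set 'rV[R]_n)^nat) :
  (forall i, g_sigma_preimage rV_coord (F i)) ->
  g_sigma_preimage rV_coord (\bigcup_i (F i)).
Proof. exact: sigma_algebra_bigcup. Qed.

HB.instance Definition _ := @isMeasurable.Build rV_display 'rV[R]_n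
  (g_sigma_preimage rV_coord) rV_set0 rV_setC rV_bigcup.

End measurable_rV.

Section rV_cons.
Context (R : realType).

Lemma measurable_rV_coord n (i : 'I_n) :
  measurable_fun [set: 'rV[R]_n] (@rV_coord R n i).
Proof.
move=> _ Y mY; rewrite setTI; apply: sub_sigma_algebra => /=.
rewrite -bigcup_seq/=; exists i => /=; first by rewrite mem_index_enum.
by exists Y => //; rewrite setTI.
Qed.

Lemma measurable_fun_rVP d (T : measurableType d) n (f : T -> 'rV[R]_n) :
  (forall i, measurable_fun [set: T] (@rV_coord R n i \o f)) ->
  measurable_fun [set: T] f.
Proof.
move=> mf.
have H : g_sigma_preimage (fun i => @rV_coord R n i \o f) `<=` measurable.
  apply: smallest_sub; first exact: sigma_algebra_measurable.
  case: n => [|n] in f mf *; first by rewrite big_ord0.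
  rewrite -bigcup_mkord_ord; apply: bigcup_sub => i Ii.
  by move=> A [B mB <-]; exact: mf.
move=> _ A mA; apply: H; rewrite g_sigma_preimage_comp.
by exists A.
Qed.

Definition rV_cons n (z : measurableTypeR R * 'rV[R]_n) : 'rV[R]_n.+1 :=
  row_mx (z.1 : R)%:M z.2.

Definition rV_uncons n (x : 'rV[R]_n.+1) : measurableTypeR R * 'rV[R]_n :=
  (x ord0 ord0, \row_i x ord0 (lift ord0 i)).

Lemma rV_cons0 n z : @rV_cons n z ord0 ord0 = z.1.
Proof.
rewrite /rV_cons mxE; case: splitP => [j _|k]; last by [].
by rewrite !ord1 mxE eqxx mulr1n.
Qed.

Lemma rV_consS n z i : @rV_cons n z ord0 (lift ord0 i) = z.2 ord0 i.
Proof.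
rewrite /rV_cons mxE; case: splitP => [j|k].
  by rewrite ord1.
by rewrite /= /bump/= !add1n => -[] /val_inj ->.
Qed.

Lemma rV_consK n : cancel (@rV_cons n) (@rV_uncons n).
Proof.
move=> [a x]; rewrite /rV_uncons rV_cons0; congr pair.
by apply/rowP => i; rewrite mxE rV_consS.
Qed.

Lemma rV_unconsK n : cancel (@rV_uncons n) (@rV_cons n).
Proof.
move=> x; apply/rowP => i; case: (unliftP ord0 i) => [j ->|->].
  by rewrite rV_consS mxE.
by rewrite rV_cons0.
Qed.

Lemma measurable_rV_cons n :
  measurable_fun [set: (measurableTypeR R * 'rV[R]_n)%type] (@rV_cons n).
Proof.
apply: measurable_fun_rVP => i; case: (unliftP ord0 i) => [j ->|->].
  rewrite (_ : _ \o _ = @rV_coord R n j \o snd); last first.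
    by apply/funext => z; rewrite /= /rV_coord rV_consS.
  by apply: measurableT_comp => //; exact: measurable_rV_coord.
rewrite (_ : _ \o _ = fst) //.
by apply/funext => z; rewrite /= /rV_coord rV_cons0.
Qed.

Lemma measurable_rV_uncons n :
  measurable_fun [set: 'rV[R]_n.+1] (@rV_uncons n).
Proof.
apply/measurable_fun_pairP; split; first exact: measurable_rV_coord.
apply: measurable_fun_rVP => i.
rewrite (_ : _ \o _ = @rV_coord R n.+1 (lift ord0 i)).
  exact: measurable_rV_coord.
by apply/funext => z; rewrite /= /rV_coord mxE.
Qed.

End rV_cons.

Section lebesgue_rV_step.
Context (R : realType) (n : nat).
Variable m : {sigma_finite_measure set 'rV[R]_n -> \bar R}.

Definition lebesgue_rV_step : set 'rV[R]_n.+1 -> \bar R :=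
  pushforward (@lebesgue_measure R \x m)%E (@rV_cons R n).

Let mstep : {measure set 'rV[R]_n.+1 -> \bar R} :=
  measure_function_pushforward__canonical__measure_function_Measure
    (@lebesgue_measure R \x m :
      {measure set (measurableTypeR R * 'rV[R]_n)%type -> \bar R})%E
    (@measurable_rV_cons R n).

HB.instance Definition _ := isMeasure.Build _ _ _ lebesgue_rV_step
  (measure0 mstep) (measure_ge0 mstep) (@measure_semi_sigma_additive _ _ _ mstep).

Let lebesgue_rV_step_sigma_finite : sigma_finite setT lebesgue_rV_step.
Proof.
have /sigma_finiteP[F [TF ndF Foo]] := sigma_finiteT (@lebesgue_measure R).
have /sigma_finiteP[G [TG ndG Goo]] := sigma_finiteT m.
exists (fun k => @rV_uncons R n @^-1` (F k `*` G k)).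
  rewrite -preimage_bigcup [X in _ @^-1` X](_ : _ = setT) ?preimage_setT//.
  apply/seteqP; split => // -[x y] _.
  have [k _ Fkx] : (\bigcup_i F i) x by rewrite -TF.
  have [l _ Gly] : (\bigcup_i G i) y by rewrite -TG.
  exists (maxn k l) => //; split.
  - by move: x Fkx; exact/subsetPset/ndF/leq_maxl.
  - by move: y Gly; exact/subsetPset/ndG/leq_maxr.
move=> k; have [mF Fk] := Foo k; have [mG Gk] := Goo k; split.
  rewrite -[X in measurable X]setTI; apply: measurable_rV_uncons => //.
  exact: measurableX.
rewrite /lebesgue_rV_step /pushforward -comp_preimage.
rewrite (_ : _ \o _ = id) ?preimage_id; last first.
  by apply/funext => z; exact: rV_consK.
by rewrite product_measure1E// lte_mul_pinfty// ge0_fin_numE.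
Qed.

HB.instance Definition _ := Measure_isSigmaFinite.Build _ _ _
  lebesgue_rV_step lebesgue_rV_step_sigma_finite.

End lebesgue_rV_step.

(* The n-fold product of the Lebesgue measure on R, normalised on boxes by
   lebesgue_rV_box. *)
Fixpoint lebesgue_rV (R : realType) (n : nat) :
    {sigma_finite_measure set 'rV[R]_n -> \bar R} :=
  match n with
  | 0 => \d_ (0 : 'rV[R]_0)
  | n.+1 => lebesgue_rV_step (lebesgue_rV R n)
  end.

Lemma lebesgue_rV_box (R : realType) n (A : 'I_n -> set (measurableTypeR R)) :
  (forall i, measurable (A i)) ->
  lebesgue_rV R n [set x | forall i, A i (x ord0 i)] =
  (\prod_(i < n) lebesgue_measure (A i))%E.
Proof.
elim: n A => [|n IH] A mA /=.
  rewrite big_ord0 diracE mem_set//; by case.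
have mB : measurable [set x : 'rV[R]_n | forall i, A (lift ord0 i) (x ord0 i)].
  rewrite (_ : mkset _ = \bigcap_(i in [set: 'I_n])
      (@rV_coord R n i @^-1` A (lift ord0 i))); last first.
    by apply/seteqP; split => x /= h i; [move=> _|]; exact: h.
  apply: fin_bigcap_measurable => // i _.
  by rewrite -[X in measurable X]setTI; exact: measurable_rV_coord.
rewrite big_ord_recl -(IH (fun i => A (lift ord0 i)))//.
rewrite -product_measure1E//.
rewrite /lebesgue_rV_step /pushforward; congr (_ _).
apply/seteqP; split => [z /= h|z /= [h0 h] i].
  split; first by have := h ord0; rewrite rV_cons0.
  by move=> i; have := h (lift ord0 i); rewrite rV_consS.
by case: (unliftP ord0 i) => [j ->|->]; rewrite ?rV_consS ?rV_cons0.
Qed.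

Section borel_rV.
Context (R : realType) (n : nat).

Lemma open_measurable_rV (U : set 'rV[R]_n) : open U -> measurable U.
Proof.
move=> oU.
have aux1 (a b c d f : R) : a - d < c -> c < a + d -> c - d < b -> b < c + d ->
    d < f / 2 -> - f < a - b < f by move=> *; apply/andP; split; lra.
have aux2 (a c d : R) : a - d < c -> c < a + d -> c - d < a < c + d.
  by move=> *; apply/andP; split; lra.
pose B (p : 'rV[rat]_n * nat) : set 'rV[R]_n :=
  \bigcap_(i in [set: 'I_n]) (@rV_coord R n i @^-1`
    `]ratr (p.1 ord0 i) - p.2.+1%:R^-1, ratr (p.1 ord0 i) + p.2.+1%:R^-1[%classic).
have mB p : measurable (B p).
  apply: fin_bigcap_measurable => // i _.
  by rewrite -[X in measurable X]setTI; exact: measurable_rV_coord.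
rewrite (_ : U = \bigcup_(p in [set p | B p `<=` U]) B p); last first.
  apply/seteqP; split => [x Ux|x [p pU]]; last exact: pU.
  have /nbhs_ballP[e /= e0 xeU] := open_nbhs_nbhs (conj oU Ux).
  have [k ke] : exists k : nat, k.+1%:R^-1 < e / 2.
    have [k _ /(_ k (leqnn k))] := near_infty_natSinv_lt
      (PosNum (divr_gt0 e0 (ltr0n R 2))).
    by exists k.
  have k0 : 0 < k.+1%:R^-1 :> R by rewrite invr_gt0 ltr0n.
  have /choice[q qP] : forall i : 'I_n, exists q : rat,
      ratr q \in `]x ord0 i - k.+1%:R^-1, x ord0 i + k.+1%:R^-1[.
    by move=> i; apply: rat_in_itvoo; rewrite ltrD2l gtrN.
  exists (\row_i q i, k) => [y /= yB|i _ /=].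
    apply: xeU; split => // i j; rewrite ord1 /ball/=.
    have := yB j I; rewrite /= mxE in_itv/= => /andP[y1 y2].
    have := qP j; rewrite in_itv/= => /andP[q1 q2].
    rewrite ltr_norml; exact: (aux1 _ _ _ _ _ q1 q2 y1 y2 ke).
  rewrite mxE in_itv/=; have := qP i; rewrite in_itv/= /rV_coord => /andP[q1 q2].
  exact: (aux2 _ _ _ q1 q2).
rewrite bigcup_mkcond; apply: countable_bigcupT_measurable; first exact/countableP.
by move=> p; case: ifP.
Qed.

Lemma measurable_rV_borel :
  @measurable _ 'rV[R]_n = <<s [set U : set 'rV[R]_n | open U] >>.
Proof.
apply/seteqP; split; last first.
  apply: smallest_sub; first exact: sigma_algebra_measurable.
  by move=> U; exact: open_measurable_rV.
pose T := g_sigma_algebraType [set U : set 'rV[R]_n | open U].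
have mcoord (i : 'I_n) : measurable_fun [set: T] (@rV_coord R n i).
  apply: (measurability (@measurable_realfun.RGenOpens.G R)).
    exact: measurable_realfun.RGenOpens.measurableE.
  move=> _ [_ [a [b ->] <-]]; rewrite setTI; apply: sub_sigma_algebra => /=.
  have /continuousP := @coord_continuous R 1 n ord0 i; apply.
  exact: interval_open.
apply: smallest_sub; first exact: smallest_sigma_algebra.
move=> A; rewrite -bigcup_seq/= => -[i _ [B mB <-]].
exact: mcoord.
Qed.

End borel_rV.

Section problem.
Context (R : realType) (n : nat).
Implicit Types (T : set 'rV[R]_n) (I : {fset multinom n}) (x t : 'rV[R]_n).

Definition eucl_norm x : R := Num.sqrt (\sum_(k < n) x ord0 k ^+ 2).

Definition regular_closed T :=
  [/\ closed T, T !=set0 &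
      forall t eps, T t -> 0 < eps ->
        (0 < lebesgue_rV R n [set x | T x /\ (eucl_norm (x - t) < eps)%R])%E].

(* sigma_i: each coordinate of i is either kept or replaced by 0. *)
Definition subindices (i : multinom n) : set (multinom n) :=
  [set j | forall k : 'I_n, j k = 0%N \/ j k = i k].

Definition regular_indices I :=
  I != fset0 /\ forall i, i \in I -> forall j, subindices i j -> j \in I.

Definition monomial (i : multinom n) t : R := \prod_(k < n) t ord0 k ^+ i k.

(* mpoly n R is R[X_1, ..., X_n], with monomials mpolyX R i = X^i, i : multinom n. *)
Definition monomial_span I : set (mpoly n R) :=
  [set p | exists c : multinom n -> R, p = \sum_(i <- I) c i *: mpolyX R i].

(* The functional on the span of the X^i, i in I (see riesz_sum); g is a total
   function of which only the values on I are used. *)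
Definition riesz I (g : multinom n -> R) (p : mpoly n R) : R :=
  \sum_(i <- I) g i * mcoeff i p.

Lemma riesz_sum I (g c : multinom n -> R) :
  riesz I g (\sum_(i <- I) c i *: mpolyX R i) = \sum_(i <- I) g i * c i.
Proof.
rewrite /riesz big_seq [RHS]big_seq; apply: eq_bigr => i iI.
congr (_ * _); rewrite raddf_sum/= (bigD1_seq i)//= mcoeffZ mcoeffX eqxx mulr1.
rewrite big1 ?addr0// => j ji.
by rewrite mcoeffZ mcoeffX (negbTE ji) mulr0.
Qed.

End problem.

(* Main.v *)
Require Import Defs.
From HB Require Import structures.
From mathcomp Require Import all_boot all_order all_algebra finmap.
From mathcomp Require Import -(notations) mpoly.
From mathcomp Require Import all_classical all_reals all_analysis.
From mathcomp Require Import ring lra measurable_realfun.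

(** Integration against a density f turns the functional p |-> sum_i c_i g_i
    into p |-> int_T p f, and the theorem compares the positivity of the two.

    From (a) to (b): if p is nonzero and nonnegative on T then p f >= 0, so
    int_T p f >= 0, and equality would force p f = 0 almost everywhere. The
    zero set of a nonzero polynomial is Lebesgue-null (zeros_null), so f would
    vanish almost everywhere on T, against int_T f = g_0 = 1. This is
    has_moments_gt0.

    From (b) to (a): the moment vectors of nonnegative functions form a convex
    cone C in the finite-dimensional space R^I. If g is not in C, then some
    nonzero linear form c satisfies c.g <= 0 and c >= 0 on C
    (cone_separation); C need not be closed for this, because a proper convex
    cone in finite dimension always lies in a closed half-space
    (cone_support). Let p be the polynomial with coefficients c. If p were
    negative at a point of T, it would be negative on a neighbourhood A of
    that point in T, which has positive measure by the regularity of T, and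
    the indicator of A would have a moment vector on which c is negative.
    So p is nonnegative on T (moment_functional_ge0), while the functional is
    nonpositive at p: this contradicts (b). The density obtained satisfies
    f >= 0 everywhere (has_moments_exists). *)

Import Order.TTheory GRing.Theory Num.Theory.
Import numFieldNormedType.Exports.

Local Open Scope classical_set_scope.
Local Open Scope ring_scope.

(** * Separation of a point from a convex cone in finite dimension *)

Section cone_separation.
Set Implicit Arguments.
Unset Strict Implicit.
Context {R : realType}.

Definition convex_cone (V : lmodType R) (D : set V) :=
  [/\ D 0, forall x y, D x -> D y -> D (x + y) &
      forall a x, 0 < a -> D x -> D (a *: x)].

Definition dotv n (c x : 'rV[R]_n) := \sum_(k < n) c ord0 k * x ord0 k.

Lemma rV_consD n (s u : R) (x y : 'rV[R]_n) :
  rV_cons (s + u, x + y) = rV_cons (s, x) + rV_cons (u, y).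
Proof.
apply/rowP => i; rewrite [RHS]mxE; case: (unliftP ord0 i) => [j ->|->].
  by rewrite !rV_consS mxE.
by rewrite !rV_cons0.
Qed.

Lemma rV_consZ n (a s : R) (x : 'rV[R]_n) :
  rV_cons (a * s, a *: x) = a *: rV_cons (s, x).
Proof.
apply/rowP => i; rewrite [RHS]mxE; case: (unliftP ord0 i) => [j ->|->].
  by rewrite !rV_consS mxE.
by rewrite !rV_cons0.
Qed.

Lemma rV_cons00 n : rV_cons (0 : R, 0 : 'rV[R]_n) = 0.
Proof. by have := @rV_consZ n 0 0 0; rewrite mul0r !scale0r. Qed.

Lemma dotv_cons n (a s : R) (c x : 'rV[R]_n) :
  dotv (rV_cons (a, c)) (rV_cons (s, x)) = a * s + dotv c x.
Proof.
rewrite /dotv big_ord_recl !rV_cons0; congr (_ + _).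
by apply: eq_bigr => k _; rewrite !rV_consS.
Qed.

Lemma dotvDr n (c x y : 'rV[R]_n) : dotv c (x + y) = dotv c x + dotv c y.
Proof. by rewrite -big_split; apply: eq_bigr => k _; rewrite mxE mulrDr. Qed.

Lemma dotvZr n a (c x : 'rV[R]_n) : dotv c (a *: x) = a * dotv c x.
Proof. by rewrite mulr_sumr; apply: eq_bigr => k _; rewrite mxE mulrCA. Qed.

Lemma dotvNl n (c x : 'rV[R]_n) : dotv (- c) x = - dotv c x.
Proof. by rewrite -sumrN; apply: eq_bigr => k _; rewrite mxE mulNr. Qed.

(** A form of the Hahn-Banach theorem: the cone plays the role of the epigraph
    of a sublinear function on R^n, and c that of a linear minorant. The
    induction adds one coordinate at a time: once c is known on R^n, a slope a
    for the new coordinate u has to satisfy the constraints given by the points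
    of D with u = -1 (lower bounds) and with u = 1 (upper bounds). The sum of
    one point of each kind has u = 0, hence the bounds are compatible. *)
Lemma cone_above_graph n (D : set 'rV[R]_n.+1) :
  convex_cone D -> ~ D (rV_cons (-1, 0)) ->
  (forall y, exists s, D (rV_cons (s, y))) ->
  exists c : 'rV[R]_n, forall s y, D (rV_cons (s, y)) -> dotv c y <= s.
Proof.
elim: n D => [|n IH] D [D0 DD DZ] DN Dall.
  exists 0 => s y Dsy; rewrite /dotv big_ord0 leNgt; apply/negP => s0.
  apply: DN; rewrite (_ : rV_cons _ = (- s)^-1 *: rV_cons (s, y)).
    by apply: DZ => //; rewrite invr_gt0 oppr_gt0.
  rewrite -rV_consZ; congr rV_cons; congr pair; last by apply/rowP => -[].
  by rewrite invrN mulNr mulVf// lt_eqF.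
(* D' is the slice of D where the second coordinate is 0. *)
pose D' : set 'rV[R]_n.+1 := [set z |
  D (rV_cons ((rV_uncons z).1 : R, rV_cons (0 : R, (rV_uncons z).2)))].
have D'E s y : D' (rV_cons (s, y)) = D (rV_cons (s, rV_cons (0 : R, y))).
  by rewrite /D' /mkset rV_consK.
have [||s|c hc] := IH D'.
- split.
  + by rewrite -rV_cons00 D'E !rV_cons00.
  + move=> x y; rewrite -(rV_unconsK x) -(rV_unconsK y).
    case: (rV_uncons x) (rV_uncons y) => [a u] [b v].
    rewrite -rV_consD !D'E => p q; rewrite -[0]addr0 !rV_consD.
    exact: DD.
  + move=> a x a0; rewrite -(rV_unconsK x); case: (rV_uncons x) => [b u].
    rewrite -rV_consZ !D'E => p; rewrite -(mulr0 a) !rV_consZ.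
    exact: DZ.
- by rewrite D'E rV_cons00.
- by have [u Du] := Dall (rV_cons (0 : R, s)); exists u; rewrite D'E.
(* L is the set of lower bounds for the slope of the second coordinate. *)
pose L : set R := [set r | exists s y,
  D (rV_cons (s, rV_cons (-1 : R, y))) /\ r = dotv c y - s].
have key s y s' y' : D (rV_cons (s, rV_cons (1 : R, y))) ->
    D (rV_cons (s', rV_cons (-1 : R, y'))) -> dotv c y' - s' <= s - dotv c y.
  move=> p q; have := DD _ _ p q; rewrite -!rV_consD subrr -D'E => /hc.
  rewrite dotvDr; lra.
have L0 : L !=set0.
  have [s Ds] := Dall (rV_cons (-1 : R, 0)).
  by exists (dotv c 0 - s), s, 0.
have Lub : has_sup L.
  split => //; have [s Ds] := Dall (rV_cons (1 : R, 0)).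
  by exists (s - dotv c 0) => _ [s' [y' [Ds' ->]]]; exact: key Ds'.
exists (rV_cons (sup L, c)) => s z.
rewrite -(rV_unconsK z); case: (rV_uncons z) => [u y].
rewrite dotv_cons => Dz.
have [u0|u0|u0] := ltgtP u 0.
- have nu0 : 0 < (- u)^-1 by rewrite invr_gt0 oppr_gt0.
  have := DZ _ _ nu0 Dz; rewrite -!rV_consZ.
  rewrite [_ * u](_ : _ = -1); last by rewrite invrN mulNr mulVf// lt_eqF.
  move=> Dn; have : L ((- u)^-1 * (dotv c y - s)).
    by do 2 eexists; split; [exact: Dn|]; rewrite dotvZr mulrBr.
  move=> /(sup_upper_bound Lub); rewrite mulrC ler_pdivrMr ?oppr_gt0//.
  by rewrite mulrN; lra.
- have pu0 : 0 < u^-1 by rewrite invr_gt0.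
  have := DZ _ _ pu0 Dz; rewrite -!rV_consZ mulVf ?gt_eqF// => Dp.
  have : sup L <= u^-1 * (s - dotv c y).
    apply: ge_sup => // _ [s' [y' [Ds' ->]]].
    by have := key _ _ _ _ Dp Ds'; rewrite dotvZr mulrBr.
  by rewrite mulrC ler_pdivlMr//; lra.
- by move: Dz; rewrite u0 mulr0 add0r -D'E => /hc.
Qed.

(** Either the projection of D that forgets the first coordinate is a proper
    cone, and the induction hypothesis applies to it, or every vertical line
    meets D. In the latter case D cannot contain both vertical directions,
    since then it would be the whole space; if it misses the downward one,
    cone_above_graph applies to D, and if it misses the upward one, to the
    reflection of D. *)
Lemma cone_support n (D : set 'rV[R]_n) x0 :
  convex_cone D -> ~ D x0 ->
  exists2 c : 'rV[R]_n, c != 0 & forall x, D x -> 0 <= dotv c x.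
Proof.
elim: n D x0 => [|n IH] D x0 [D0 DD DZ] Dx0.
  by exfalso; apply: Dx0; rewrite (_ : x0 = 0)//; apply/rowP => -[].
have [Dall|] := pselect (forall y, exists s : R, D (rV_cons (s, y)));
  last first.
  move=> /existsNP[y Dy].
  have [|//|c c0 hc] := IH [set z | exists s : R, D (rV_cons (s, z))] y.
    split.
    - by exists 0; rewrite rV_cons00.
    - move=> u v [s Ds] [r Dr]; exists (s + r).
      by rewrite rV_consD; exact: DD.
    - by move=> a u a0 [s Ds]; exists (a * s); rewrite rV_consZ; exact: DZ.
  exists (rV_cons (0 : R, c)).
    apply: contraNneq c0 => /(congr1 (@rV_uncons R n)).
    by rewrite -rV_cons00 !rV_consK => -[->].
  move=> x; rewrite -(rV_unconsK x); case: (rV_uncons x) => [s z] Dsz.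
  by rewrite dotv_cons mul0r add0r; apply: hc; exists s.
have consE (a s : R) (y : 'rV[R]_n) :
    rV_cons (a + s, y) = rV_cons (a, 0 : 'rV_n) + rV_cons (s, y).
  by rewrite -rV_consD add0r.
have [Dn|Dn] := pselect (D (rV_cons (-1, 0))); last first.
  have [//|//|//|c hc] := @cone_above_graph n D.
  exists (rV_cons (1 : R, - c)).
    apply/eqP => /(congr1 (fun x : 'rV_n.+1 => x ord0 ord0)).
    by rewrite rV_cons0 mxE => /eqP; rewrite oner_eq0.
  move=> x; rewrite -(rV_unconsK x); case: (rV_uncons x) => [s z] Dsz.
  by rewrite dotv_cons mul1r dotvNl subr_ge0; exact: hc.
have [Dp|Dp] := pselect (D (rV_cons (1, 0))).
  exfalso; apply: Dx0; rewrite -(rV_unconsK x0).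
  case: (rV_uncons x0) => [s y]; have [r Dr] := Dall y.
  rewrite -(subrK r s) consE; apply: DD => //.
  have [sr|sr|->] := ltgtP (s - r) 0; last by rewrite rV_cons00.
    have -> : rV_cons (s - r, 0 : 'rV_n) = (- (s - r)) *: rV_cons (-1, 0).
      by rewrite -rV_consZ scaler0 mulrN1 opprK.
    by apply: DZ => //; rewrite oppr_gt0.
  have -> : rV_cons (s - r, 0 : 'rV_n) = (s - r) *: rV_cons (1, 0).
    by rewrite -rV_consZ scaler0 mulr1.
  exact: DZ.
pose D' : set 'rV[R]_n.+1 := [set z |
  D (rV_cons (- (rV_uncons z).1 : R, (rV_uncons z).2))].
have D'E (s : R) y : D' (rV_cons (s, y)) = D (rV_cons (- s, y)).
  by rewrite /D' /mkset rV_consK.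
have [||y|c hc] := @cone_above_graph n D'.
- split.
  + by rewrite -rV_cons00 D'E oppr0 rV_cons00.
  + move=> x y; rewrite -(rV_unconsK x) -(rV_unconsK y).
    case: (rV_uncons x) (rV_uncons y) => [a u] [b v].
    by rewrite -rV_consD !D'E opprD rV_consD; exact: DD.
  + move=> a x a0; rewrite -(rV_unconsK x); case: (rV_uncons x) => [b u].
    by rewrite -rV_consZ !D'E -mulrN rV_consZ; exact: DZ.
- by rewrite D'E opprK.
- by have [s Ds] := Dall y; exists (- s); rewrite D'E opprK.
exists (rV_cons (-1 : R, - c)).
  apply/eqP => /(congr1 (fun x : 'rV_n.+1 => x ord0 ord0)).
  by rewrite rV_cons0 mxE => /eqP; rewrite oppr_eq0 oner_eq0.
move=> x; rewrite -(rV_unconsK x); case: (rV_uncons x) => [s z] Dsz.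
rewrite dotv_cons dotvNl mulN1r subr_ge0; apply: hc.
by rewrite D'E opprK.
Qed.

(** The cone D generated by C and -g is proper: if g = v - s g with v in C and
    s >= 0, then g = (1 + s)^-1 v would be in C. A linear form that is
    nonnegative on D is nonnegative on C and nonpositive at g. Functions on K
    matter only through their restriction to I. *)
Lemma cone_separation (K : choiceType) (I : {fset K}) (C : set (K -> R))
    (g : K -> R) :
  C (fun=> 0) -> (forall v w, C v -> C w -> C (fun i => v i + w i)) ->
  (forall (a : R) v, 0 < a -> C v -> C (fun i => a * v i)) ->
  ~ (exists2 v, C v & forall i, i \in I -> v i = g i) ->
  exists c : K -> R, [/\ exists2 i, i \in I & c i != 0,
    forall v, C v -> 0 <= \sum_(i <- I) c i * v i &
    \sum_(i <- I) c i * g i <= 0].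
Proof.
move=> C0 CD CZ Cg.
pose N := size (enum_fset I); pose e (k : 'I_N) : K := tnth (in_tuple I) k.
pose x (v : K -> R) : 'rV[R]_N := \row_k v (e k).
have e_inj : injective e by apply/tuple_uniqP; exact: fset_uniq.
have eI k : e k \in I by exact: mem_tnth.
have [||c c0 hc] := @cone_support N
    [set y | exists v s, [/\ C v, 0 <= s & y = x v - s *: x g]] (x g).
- split.
  + exists (fun=> 0), 0; split => //.
    by rewrite scale0r subr0; apply/rowP => k; rewrite !mxE.
  + move=> _ _ [v [s [Cv s0 ->]]] [w [r [Cw r0 ->]]].
    exists (fun i => v i + w i), (s + r); split; [exact: CD|exact: addr_ge0|].
    by apply/rowP => k; rewrite !mxE; ring.
  + move=> a _ a0 [v [s [Cv s0 ->]]].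
    exists (fun i => a * v i), (a * s); split.
      exact: CZ.
      by rewrite mulr_ge0// ltW.
    by apply/rowP => k; rewrite !mxE; ring.
- move=> [v [s [Cv s0 /rowP xg]]]; apply: Cg.
  have s1 : 0 < 1 + s by rewrite ltr_wpDr.
  exists (fun i => (1 + s)^-1 * v i).
    by apply: CZ => //; rewrite invr_gt0.
  move=> i /seq_tnthP[k ik]; have := xg k; rewrite !mxE -/(e k).
  have -> : e k = i by rewrite ik.
  move=> gi; apply: (mulfI (lt0r_neq0 s1)).
  by rewrite mulrA mulfV ?gt_eqF// mul1r; lra.
have dotE v : dotv c (x v) =
    \sum_(i <- I) (\sum_(k < N | e k == i) c ord0 k) * v i.
  rewrite [RHS](big_tnth _ _ (enum_fset I)); apply: eq_bigr => k _.
  rewrite mxE -/(e k); congr (_ * _); rewrite (big_pred1 k)// => l.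
  by rewrite /= (inj_eq e_inj).
exists (fun i => \sum_(k < N | e k == i) c ord0 k); split.
- have /rV0Pn[k ck] := c0.
  exists (e k) => //; rewrite (big_pred1 k)// => l.
  by rewrite /= (inj_eq e_inj).
- move=> v Cv; rewrite -dotE; apply: hc; exists v, 0; split => //.
  by rewrite scale0r subr0.
- rewrite -dotE -oppr_ge0 -mulN1r -dotvZr; apply: hc.
  exists (fun=> 0), 1; split => //.
  by apply/rowP => k; rewrite !mxE; ring.
Qed.

End cone_separation.

(** * The zero set of a nonzero polynomial is Lebesgue-null *)

Section polynomial_zeros.
Context {R : realType}.
Set Implicit Arguments.
Unset Strict Implicit.

Lemma finite_roots (q : {poly R}) : q != 0 -> finite_set [set a | root q a].
Proof.
move=> q0; apply: contrapT => /(infinite_set_fset (size q))[B Bq].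
rewrite leqNgt => /negP; apply.
apply: max_poly_roots => //; last exact: fset_uniq.
by apply/allP => a aB; apply: (Bq a).
Qed.

Definition mnm_tail n (m : multinom n.+1) : multinom n :=
  Multinom [tuple m (lift ord0 k) | k < n].

Lemma mnm_tailE n (m : multinom n.+1) k : mnm_tail m k = m (lift ord0 k).
Proof. by rewrite mnmE. Qed.

Lemma mnm_tail_inj n (m l : multinom n.+1) :
  m ord0 = l ord0 -> mnm_tail m = mnm_tail l -> m = l.
Proof.
move=> ml0 mlS; apply/mnmP => i; case: (unliftP ord0 i) => [k ->|->] //.
by rewrite -!mnm_tailE mlS.
Qed.

(** The polynomial p(a, _) in the last n variables. *)
Definition slice n (p : mpoly n.+1 R) (a : R) : mpoly n R :=
  \sum_(m <- msupp p) (mcoeff m p * a ^+ m ord0) *: mpolyX R (mnm_tail m).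

Lemma meval_slice n (p : mpoly n.+1 R) a (y : 'rV[R]_n) :
  meval (rV_cons (a, y) ord0) p = meval (y ord0) (slice p a).
Proof.
rewrite mevalE /slice raddf_sum/=; apply: eq_bigr => m _.
rewrite mevalZ mevalX big_ord_recl rV_cons0 mulrA; congr (_ * _).
by apply: eq_bigr => k _; rewrite rV_consS mnm_tailE.
Qed.

(** If m0 is a monomial of p, the coefficient in p(a, _) of the tail of m0 is
    the value at a of a polynomial q, whose coefficient at the head of m0 is
    that of p at m0, hence nonzero. *)
Lemma slice_neq0 n (p : mpoly n.+1 R) : p != 0 ->
  exists2 q : {poly R}, q != 0 & forall a, ~~ root q a -> slice p a != 0.
Proof.
rewrite -msupp_eq0; case ms: (msupp p) => [//|m0 s] _.
have m0p : m0 \in msupp p by rewrite ms mem_head.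
pose q : {poly R} := \sum_(m <- msupp p | mnm_tail m == mnm_tail m0)
  mcoeff m p *: 'X^(m ord0).
exists q.
  suff q_m0 : q`_(m0 ord0) = mcoeff m0 p.
    move: m0p; rewrite mcoeff_msupp -q_m0.
    by apply: contraNneq => ->; rewrite coef0.
  rewrite coef_sum big_mkcond (bigD1_seq m0)//= eqxx coefZ coefXn eqxx mulr1.
  rewrite big1 ?addr0// => m mm0; case: eqP => // mt.
  rewrite coefZ coefXn; case: eqP => [m0E|_]; last by rewrite mulr0.
  by rewrite (mnm_tail_inj (esym m0E) mt) eqxx in mm0.
move=> a; apply: contraNneq => pa.
have : mcoeff (mnm_tail m0) (slice p a) = 0 by rewrite pa raddf0.
rewrite /root => <-; apply/eqP.
rewrite /slice raddf_sum/= horner_sum big_mkcond; apply: eq_bigr => m _.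
rewrite mcoeffZ mcoeffX; case: eqP => _; last by rewrite mulr0.
by rewrite hornerZ hornerXn mulr1.
Qed.

Lemma measurable_monomial n (i : multinom n) :
  measurable_fun [set: 'rV[R]_n] (fun t => monomial i t : R).
Proof.
apply: measurable_prod => k _; apply: measurable_funX.
exact: measurable_rV_coord.
Qed.

Lemma measurable_meval n (p : mpoly n R) :
  measurable_fun [set: 'rV[R]_n] (fun t => meval (t ord0) p : R).
Proof.
rewrite (_ : (fun t => _) =
    fun t => \sum_(m <- msupp p) mcoeff m p * monomial m t).
  apply: measurable_sum => m; apply: measurable_funM => //.
  exact: measurable_monomial.
by apply/funext => t; rewrite mevalE.
Qed.

Lemma measurable_zeros n (p : mpoly n R) :
  measurable [set t : 'rV[R]_n | meval (t ord0) p = 0].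
Proof.
have := @measurable_meval n p measurableT [set 0] (measurable_set1 _).
by rewrite setTI.
Qed.

(** By Fubini, as only finitely many a make p(a, _) the zero polynomial; for
    the others the section of the zero set at a is null by induction. *)
Lemma zeros_null n (p : mpoly n R) : p != 0 ->
  lebesgue_rV R n [set t | meval (t ord0) p = 0] = 0%E.
Proof.
elim: n p => [|n IH] p p0.
  rewrite /= diracE memNset// => /=.
  move: p0; rewrite -msupp_eq0 mevalE.
  have m0 (m : multinom 0) : m = mnm0 by apply/mnmP => -[].
  have := msupp_uniq p; have := @mcoeff_msupp _ _ p mnm0.
  case: (msupp p) => [//|m [|l s]].
    rewrite (m0 m) mem_head => /esym p0 _ _.
    by rewrite big_seq1 big_ord0 mulr1 => /eqP; exact/negP.
  by move=> _ /=; rewrite (m0 m) (m0 l) mem_head.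
have [q q0 qp] := slice_neq0 p0.
rewrite /= /lebesgue_rV_step /pushforward /= /product_measure1.
set A := _ @^-1` _.
have mA : measurable A.
  rewrite -[A]setTI; apply: measurable_rV_cons => //; exact: measurable_zeros.
rewrite -[RHS](@integral0 _ _ R lebesgue_measure setT).
apply: ae_eq_integral => //.
  exact: measurable_fun_xsection.
exists [set a | root q a]; split.
- apply: countable_measurable; last exact/finite_set_countable/finite_roots.
  by move=> t; exact: measurable_set1.
- by apply/countable_lebesgue_measure0/finite_set_countable/finite_roots.
- move=> a; apply: contra_notP => /negP/qp/IH <- _ /=.
  congr (lebesgue_rV R n _).
  by apply/seteqP; split => y; rewrite /xsection /= inE /A /= meval_slice.
Qed.

End polynomial_zeros.

(** * Integrals of almost everywhere nonnegative functions *)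

Section ae_positive_integral.
Local Open Scope ereal_scope.
Context d (T : measurableType d) (R : realType).
Variable mu : {measure set T -> \bar R}.

Lemma ae_abse_integral (D : set T) (F : T -> \bar R) :
  measurable D -> measurable_fun D F -> {ae mu, forall x, D x -> 0 <= F x} ->
  \int[mu]_(x in D) F x = \int[mu]_(x in D) `|F x|.
Proof.
move=> mD mF F0; apply: ae_eq_integral => //.
  exact: measurableT_comp.
by apply: filterS F0 => x F0 Dx; rewrite gee0_abs// F0.
Qed.

Lemma ae_integral_gt0 (D : set T) (F : T -> \bar R) :
  measurable D -> measurable_fun D F -> {ae mu, forall x, D x -> 0 <= F x} ->
  ~ {ae mu, forall x, D x -> F x = 0} -> 0 < \int[mu]_(x in D) F x.
Proof.
move=> mD mF F0 nF; rewrite ae_abse_integral// lt0e integral_ge0// andbT.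
by apply/eqP => /(ae_eq_integral_abs _ mD mF).
Qed.

End ae_positive_integral.

(** * Moments *)

Section moments.
Context {R : realType} {n : nat}.
Set Implicit Arguments.
Unset Strict Implicit.
Implicit Types (T : set 'rV[R]_n) (I : {fset multinom n}) (f : 'rV[R]_n -> R).
Local Notation mu := (lebesgue_rV R n).

(** Integrability of the functions t^i f is required: otherwise the value of
    the integral would not make moments additive in f. *)
Definition has_moments T I f (g : multinom n -> R) := forall i, i \in I ->
  mu.-integrable T (fun t => (monomial i t * f t)%:E) /\
  (\int[mu]_(t in T) (monomial i t * f t)%:E = (g i)%:E)%E.

Lemma monomial0 (t : 'rV[R]_n) : monomial mnm0 t = 1.
Proof. by rewrite /monomial big1// => k _; rewrite mnm0E. Qed.

Lemma integral_polynomial T I f (c g : multinom n -> R) :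
  measurable T -> has_moments T I f g ->
  let p := \sum_(i <- I) c i *: mpolyX R i in
  mu.-integrable T (fun t => (meval (t ord0) p * f t)%:E) /\
  (\int[mu]_(t in T) (meval (t ord0) p * f t)%:E =
    (\sum_(i <- I) c i * g i)%:E)%E.
Proof.
move=> mT fg p.
pose h i t : \bar R :=
  if i \in I then ((c i)%:E * (monomial i t * f t)%:E)%E else 0%E.
have hE (t : 'rV[R]_n) : ((meval (t ord0) p * f t)%:E = \sum_(i <- I) h i t)%E.
  rewrite /p raddf_sum/= mulr_suml -sumEFin big_seq [RHS]big_seq.
  apply: eq_bigr => i iI; rewrite /h iI -EFinM mevalZ mevalX.
  by rewrite mulrA.
have inth i : mu.-integrable T (h i).
  rewrite /h; have [iI|_] := boolP (i \in I); last exact: integrable0.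
  by apply: integrableZl => //; exact: (fg i iI).1.
under eq_fun do rewrite hE.
split; first exact: integrable_sum.
rewrite integral_sum// -sumEFin big_seq [RHS]big_seq; apply: eq_bigr => i iI.
by have [fi fgi] := fg i iI; rewrite /h iI integralZl// fgi.
Qed.

Lemma closed_measurable_rV T : closed T -> measurable T.
Proof.
move=> cT; rewrite -(setCK T); apply: measurableC; apply: open_measurable_rV.
exact: closed_openC.
Qed.

Lemma eucl_norm_coord (x : 'rV[R]_n) k : `|x ord0 k| <= eucl_norm x.
Proof.
rewrite -sqrtr_sqr ler_wsqrtr// (bigD1 k)//= lerDl.
by apply: sumr_ge0 => i _; exact: sqr_ge0.
Qed.

Lemma measurable_eucl_ball (t : 'rV[R]_n) (e : R) : 0 < e ->
  measurable [set x | eucl_norm (x - t) < e].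
Proof.
move=> e0; pose h (x : 'rV[R]_n) : R := \sum_(k < n) (x ord0 k - t ord0 k) ^+ 2.
have mh : measurable_fun setT h.
  apply: measurable_sum => k; apply: measurable_funX.
  apply: measurable_funB => //.
  exact: measurable_rV_coord.
have hE x : (eucl_norm (x - t) < e) = (h x < e ^+ 2).
  rewrite -[e in LHS]gtr0_norm// -sqrtr_sqr ltr_sqrt ?exprn_gt0//.
  by congr (_ < _); apply: eq_bigr => k _; rewrite !mxE.
rewrite (_ : [set x | _] = setT `&` h @^-1` `]-oo, e ^+ 2[%classic).
  exact: mh.
by rewrite setTI; apply/seteqP; split => x /=; rewrite in_itv/= hE.
Qed.

(** Only the boundedness of this neighbourhood of t matters: its measure is
    finite and the monomials are bounded on it. *)
Definition cube (t : 'rV[R]_n) : set 'rV[R]_n :=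
  [set x | forall k, `|x ord0 k - t ord0 k| < 1].

Lemma cubeE (t : 'rV[R]_n) :
  cube t = [set x | forall k, `]t ord0 k - 1, t ord0 k + 1[%classic (x ord0 k)].
Proof.
by apply/seteqP; split => x + k => /(_ k); rewrite /= in_itv/= ltr_norml;
  move=> /andP[? ?]; apply/andP; split; lra.
Qed.

Lemma measurable_cube (t : 'rV[R]_n) : measurable (cube t).
Proof.
rewrite (_ : cube t = \bigcap_(k in [set: 'I_n])
  (@rV_coord R n k @^-1` `]t ord0 k - 1, t ord0 k + 1[%classic)); last first.
  by rewrite cubeE; apply/seteqP; split => x /= h k; [move=> _|]; exact: h.
apply: fin_bigcap_measurable => // k _.
by rewrite -[X in measurable X]setTI; exact: measurable_rV_coord.
Qed.

Lemma lebesgue_rV_cube_fin (t : 'rV[R]_n) : (mu (cube t) < +oo)%E.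
Proof.
pose B k : set (measurableTypeR R) := `]t ord0 k - 1, t ord0 k + 1[%classic.
have -> : mu (cube t) = (\prod_(k < n) lebesgue_measure (B k))%E.
  by rewrite cubeE -lebesgue_rV_box// => k; exact: measurable_itv.
under eq_bigr => k _.
  rewrite lebesgue_measure_itv/= lte_fin.
  rewrite (_ : _ < _) -?EFinB; last by lra.
  over.
by rewrite prodEFin ltry.
Qed.

Lemma monomial_cube_bound (t : 'rV[R]_n) (i : multinom n) (x : 'rV[R]_n) :
  cube t x -> `|monomial i x| <= \prod_(k < n) (`|t ord0 k| + 1) ^+ i k.
Proof.
move=> xt; rewrite /monomial normr_prod; apply: ler_prod => k _.
rewrite normr_ge0/= normrX lerXn2r// ?nnegrE ?addr_ge0//.
rewrite -[x ord0 k](subrKC (t ord0 k)) (le_trans (ler_normD _ _))//.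
by rewrite lerD2l ltW// xt.
Qed.

Lemma integrable_monomial_indic T A (t : 'rV[R]_n) (i : multinom n) :
  measurable T -> measurable A -> A `<=` cube t ->
  mu.-integrable T (fun x => (monomial i x * \1_A x)%:E).
Proof.
move=> mT mA Acube.
have muA : (mu A < +oo)%E.
  apply: le_lt_trans (lebesgue_rV_cube_fin t).
  by apply: le_measure; rewrite ?inE//; exact: measurable_cube.
have : mu.-integrable A (EFin \o monomial i).
  apply: measurable_bounded_integrable => //.
    by apply: measurable_funTS; exact: measurable_monomial.
  exists (\prod_(k < n) (`|t ord0 k| + 1) ^+ i k); split; first exact: num_real.
  move=> M tM x Ax; apply: le_trans (ltW tM).
  exact: monomial_cube_bound (Acube _ Ax).
move=> /(integrable_mkcond _ mA) /(integrableS measurableT mT (@subsetT _ _)).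
apply: eq_integrable => // x _.
rewrite patchE indicE; case: ifPn => _ /=; by rewrite ?mulr1 ?mulr0.
Qed.

Lemma meval_continuous (p : mpoly n R) :
  continuous (fun t : 'rV[R]_n => meval (t ord0) p).
Proof.
rewrite (_ : (fun t => _) = fun t : 'rV[R]_n =>
    \sum_(m <- msupp p) mcoeff m p * \prod_(k < n) t ord0 k ^+ m k); last first.
  by apply/funext => t; rewrite mevalE.
apply: (continuous_big (@add_continuous R)) => m _ t.
apply: continuousM; first exact: cst_continuous.
move: t; apply: (continuous_big (@mul_continuous R)) => k _ t.
apply: (@continuous_comp _ _ _ (fun t : 'rV[R]_n => t ord0 k)
  (fun x : R => x ^+ m k)); first exact: coord_continuous.
exact: exprn_continuous.
Qed.

(** The regularity of T guarantees that a violation of p >= 0 at a single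
    point of T is seen by integration over T. *)
Lemma negative_near T (p : mpoly n R) t : regular_closed T -> T t ->
  meval (t ord0) p < 0 ->
  exists A : set 'rV[R]_n, [/\ measurable A, A `<=` T, (0 < mu A)%E,
    A `<=` cube t &
    forall x, A x -> meval (x ord0) p < 0].
Proof.
move=> [cT _ Treg] Tt pt.
have : nbhs t [set x : 'rV[R]_n | meval (x ord0) p < 0].
  exact: (cvgr_lt _ (@meval_continuous p t) _ pt).
move=> /nbhs_ballP[e /= e0 pe].
pose r := Num.min e 1; have r0 : 0 < r by rewrite lt_min e0 ltr01.
have rP x : eucl_norm (x - t) < r -> forall k, `|x ord0 k - t ord0 k| < r.
  move=> xr k; apply: le_lt_trans xr; have := eucl_norm_coord (x - t) k.
  by rewrite !mxE.
exists [set x | T x /\ eucl_norm (x - t) < r]; split.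
- apply: measurableI; first exact: closed_measurable_rV.
  exact: measurable_eucl_ball.
- by move=> x [].
- exact: Treg.
- by move=> x [_ /rP xr] k; rewrite (lt_le_trans (xr k))// ge_min lexx orbT.
- move=> x [_ /rP xr]; apply: pe; split=> // i k; rewrite ord1 /ball/= distrC.
  by rewrite (lt_le_trans (xr k))// ge_min lexx.
Qed.

(** If the integral of p f vanished, p f would be 0 almost everywhere, hence
    also f because p vanishes on a null set only; but f has a nonzero moment
    at the multi-index 0. *)
Lemma has_moments_gt0 T I f (c g : multinom n -> R) :
  measurable T -> {ae mu, forall t, T t -> 0 <= f t} ->
  mnm0 \in I -> g mnm0 != 0 -> has_moments T I f g ->
  let p := \sum_(i <- I) c i *: mpolyX R i in
  p != 0 -> (forall t, T t -> 0 <= meval (t ord0) p) ->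
  0 < \sum_(i <- I) c i * g i.
Proof.
move=> mT f0 zI g0 fg p p0 pT.
have [/integrableP[mpf _] pf] := integral_polynomial c mT fg.
rewrite -lte_fin -pf; apply: ae_integral_gt0 => //.
  by apply: filterS f0 => t f0 Tt; rewrite lee_fin mulr_ge0// ?pT// f0.
move=> pf0.
have f_eq0 : {ae mu, forall t, T t -> (f t)%:E = 0%E}.
  have pn0 : {ae mu, forall t : 'rV[R]_n, meval (t ord0) p <> 0}.
    exists [set t : 'rV[R]_n | meval (t ord0) p = 0]; split.
    - exact: measurable_zeros.
    - exact: zeros_null.
    - by move=> t /= /contrapT.
  apply: filterS2 pf0 pn0 => t pf0 pn0 /pf0 /eqP.
  by rewrite eqe mulf_eq0 => /orP[/eqP//|/eqP->].
have [/integrableP[mf _]] := fg _ zI.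
rewrite (ae_eq_integral (cst 0%E))//; last first.
  by apply: filterS f_eq0 => t + Tt => /(_ Tt); rewrite monomial0 mul1r.
by rewrite integral0 => -[] /esym/eqP; exact/negP.
Qed.

Lemma has_moments_indic T I A (t : 'rV[R]_n) :
  measurable T -> measurable A -> A `<=` cube t ->
  has_moments T I \1_A
    (fun i => fine (\int[mu]_(x in T) (monomial i x * \1_A x)%:E)).
Proof.
move=> mT mA At i _; have intA := integrable_monomial_indic i mT mA At.
by split => //; rewrite fineK//; exact: integrable_fin_num.
Qed.

(** Tested against the indicators of small pieces of T only: the integral of p
    over such a piece around a point where p < 0 is negative. *)
Lemma moment_functional_ge0 T I (c : multinom n -> R) :
  regular_closed T ->
  (forall f v, (forall t, 0 <= f t) -> has_moments T I f v ->
    0 <= \sum_(i <- I) c i * v i) ->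
  forall t, T t -> 0 <= meval (t ord0) (\sum_(i <- I) c i *: mpolyX R i).
Proof.
move=> Treg cC t Tt; have [cT _ _] := Treg.
have mT := closed_measurable_rV cT.
set p := \sum_(i <- I) _; rewrite leNgt; apply/negP => pt.
have [A [mA AT muA Acube Ap]] := negative_near Treg Tt pt.
have Av := has_moments_indic (I := I) mT mA Acube.
have [intpA pA] := integral_polynomial c mT Av.
have /integrableP[mpA _] := intpA.
suff : (0 < \int[mu]_(x in T) (- (meval (x ord0) p * \1_A x)%:E))%E.
  rewrite integralN ?pA; last exact: integrable_add_def.
  rewrite -EFinN lte_fin oppr_gt0 ltNge => /negP; apply.
  by apply: cC Av => x; rewrite indicE.
apply: ae_integral_gt0 => //.
- exact: measurableT_comp.
- apply: aeW => x Tx; rewrite -EFinN lee_fin indicE.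
  case: (boolP (x \in A)) => [|_]; last by rewrite mulr0 oppr0.
  by rewrite inE => /Ap/ltW; rewrite mulr1 oppr_ge0.
- move=> [N [mN N0 AN]]; move: muA; rewrite lt0e => /andP[/eqP + _]; apply.
  apply: (subset_measure0 _ _ _ N0) => //.
  apply: subset_trans AN => x Ax /= /(_ (AT _ Ax)).
  rewrite indicE mem_set// mulr1 => -[] /eqP.
  by rewrite oppr_eq0 lt_eqF// Ap.
Qed.

Lemma polynomial_neq0 I (c : multinom n -> R) i : i \in I -> c i != 0 ->
  \sum_(j <- I) c j *: mpolyX R j != 0.
Proof.
move=> iI; apply: contraNneq => p0.
have : mcoeff i (\sum_(j <- I) c j *: mpolyX R j) = 0 by rewrite p0 raddf0.
rewrite raddf_sum/= (bigD1_seq i)//= mcoeffZ mcoeffX eqxx mulr1.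
rewrite big1 ?addr0 => [->//|j ij].
by rewrite mcoeffZ mcoeffX (negbTE ij) mulr0.
Qed.

(** The separation of g from the cone C of moment vectors of nonnegative
    functions would give a polynomial that contradicts the hypothesis. *)
Lemma has_moments_exists T I (g : multinom n -> R) : regular_closed T ->
  (forall c, let p := \sum_(i <- I) c i *: mpolyX R i in
    p != 0 -> (forall t, T t -> 0 <= meval (t ord0) p) ->
    0 < \sum_(i <- I) c i * g i) ->
  exists2 f, (forall t, 0 <= f t) & has_moments T I f g.
Proof.
move=> Treg gpos; apply: contrapT => nf.
have [cT _ _] := Treg; have mT := closed_measurable_rV cT.
pose C : set (multinom n -> R) :=
  [set v | exists2 f, (forall t, 0 <= f t) & has_moments T I f v].
have [||||c [[j jI cj0] cC cg]] := @cone_separation R _ I C g.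
- exists (fun=> 0) => // i iI; split.
    by under eq_fun do rewrite mulr0; exact: integrable0.
  by under eq_integral do rewrite mulr0; rewrite integral0.
- move=> v w [f f0 fv] [h h0 hw].
  exists (fun t => f t + h t) => [t|i iI]; first by rewrite addr_ge0.
  have [fi fvi] := fv _ iI; have [hi hwi] := hw _ iI; split.
    by under eq_fun do rewrite mulrDr EFinD; exact: integrableD.
  under eq_integral do rewrite mulrDr EFinD.
  by rewrite integralD// fvi hwi.
- move=> a v a0 [f f0 fv].
  exists (fun t => a * f t) => [t|i iI]; first by rewrite mulr_ge0// ltW.
  have [fi fvi] := fv _ iI; split.
    by under eq_fun do rewrite mulrCA EFinM; exact: integrableZl.
  under eq_integral do rewrite mulrCA EFinM.
  by rewrite integralZl// fvi.
- move=> [v [f f0 fv] vg]; apply: nf; exists f => // i iI.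
  by rewrite -vg//; exact: fv.
move: cg; rewrite leNgt => /negP; apply; apply: gpos.
  exact: polynomial_neq0 jI cj0.
by apply: moment_functional_ge0 => // f v f0 fv; apply: cC; exists f.
Qed.

End moments.

Theorem theorem7 (R : realType) (n : nat) (T : set 'rV[R]_n)
    (I : {fset multinom n}) (g : multinom n -> R) :
  regular_closed T -> regular_indices I -> g mnm0 = 1 ->
  (exists f : 'rV[R]_n -> R,
     [/\ (lebesgue_rV R n).-integrable T (EFin \o f),
         {ae lebesgue_rV R n, forall t, T t -> 0 <= f t} &
         forall i, i \in I ->
           (\int[lebesgue_rV R n]_(t in T) (`|monomial i t| * f t)%:E < +oo)%E /\
           (\int[lebesgue_rV R n]_(t in T) (monomial i t * f t)%:E = (g i)%:E)%E])
  <->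
  (forall p : mpoly n R, monomial_span I p -> p != 0 ->
     (forall t, T t -> 0 <= meval (t ord0) p) -> 0 < riesz I g p).
Proof.
move=> Treg [I0 Ireg] g0.
have [cT _ _] := Treg; have mT := closed_measurable_rV cT.
have zI : mnm0 \in I.
  by have [i /Ireg] := fset0Pn _ I0; apply => k; left; rewrite mnm0E.
have rieszE c : riesz I g (\sum_(i <- I) c i *: mpolyX R i) =
    \sum_(i <- I) c i * g i.
  by rewrite riesz_sum; apply: eq_bigr => i _; rewrite mulrC.
split.
- move=> [f [intf f0 fg]] _ [c ->] p0 pT; rewrite rieszE.
  apply: (has_moments_gt0 (f := f) mT) p0 pT => //.
    by rewrite g0 oner_neq0.
  move=> i iI; have [fi fgi] := fg i iI; split => //.
  (* Since f >= 0 only almost everywhere, |t^i| f and |t^i f| agree almost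
     everywhere, which is enough for their integrals to be equal. *)
  have mf : measurable_fun T f by move: intf => /integrableP[/measurable_EFinP].
  have mm : measurable_fun T (@monomial R n i).
    by apply: measurable_funTS; exact: measurable_monomial.
  apply/integrableP; split; first exact/measurable_EFinP/measurable_funM.
  apply: le_lt_trans fi; rewrite le_eqVlt; apply/orP; left; apply/eqP.
  apply: ae_eq_integral => //.
  + by apply: measurableT_comp => //; exact/measurable_EFinP/measurable_funM.
  + apply/measurable_EFinP/measurable_funM => //.
    exact: measurableT_comp.
  + apply: filterS f0 => t f0 Tt.
    by rewrite abse_EFin normrM (ger0_norm (f0 Tt)).
- move=> gpos.
  have [|f f0 fg] := @has_moments_exists R n T I g Treg.
    by move=> c p p0 pT; rewrite -rieszE; apply: gpos => //; exists c.
  exists f; split; first 1 last.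
  + exact: aeW.
  + move=> i iI; have [fi fgi] := fg i iI; split => //.
    have /integrableP[_] := fi.
    by under eq_integral do rewrite abse_EFin normrM (ger0_norm (f0 _)).
  + have [+ _] := fg _ zI; apply: eq_integrable => // t _.
    by rewrite monomial0 mul1r.
Qed.
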